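(* Let $V\in\mathbb{R}_{\max}^{m\times d}$ have finite entries (all entries in $\mathbb{R}$), and let $F\in\mathbb{R}_{\max}^{d\times d}$ be irreducible with $\lambda(F)\neq-\infty$, with strongly connected critical graph $\mathcal{G}^c(F)$ and with $\lambda(F)\neq 0$. If $A=V\otimes F^{\otimes t}$ for some natural number $t$, then the discrete logarithm algorithm described in the context, applied to $A,V,F$ (with any choice of critical cycle $Z$), returns this $t$.
   Context: $\mathbb{R}_{\max}=\mathbb{R}\cup\{-\infty\}$ with $a\oplus b=\max(a,b)$, $a\otimes b=a+b$; matrix operations: $(A\oplus B)_{ij}=a_{ij}\oplus b_{ij}$, $(A\otimes B)_{ij}=\bigoplus_k a_{ik}\otimes b_{kj}$; $A^{\otimes t}$ is the $t$-th power with respect to $\otimes$, $A^{\otimes 0}=I$ (the tropical identity: $0$ on the diagonal, $-\infty$ off it). For a scalar $a\in\mathbb R$: $a^-=-a$; a scalar times a matrix ($\otimes$) adds the scalar to every entry. For $F\in\mathbb{R}_{\max}^{d\times d}$, $\mathcal{G}(F)$ is the weighted digraph on nodes $\{1,\dots,d\}$ with arcs $(i,j)$ such that $F_{ij}\neq-\infty$, with weight $F_{ij}$. $F$ is irreducible if $\mathcal{G}(F)$ is strongly connected. $\lambda(F)$ is the maximum cycle mean: the maximum over all cycles of $\mathcal{G}(F)$ of (sum of arc weights)/(length), equal to $-\infty$ if there are no cycles. If $\lambda(F)\ne-\infty$, the critical graph $\mathcal{G}^c(F)$ is the subgraph consisting of all nodes and arcs of the cycles attaining $\lambda(F)$; a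 critical cycle is a cycle of $\mathcal{G}^c(F)$, and $l(Z)$ denotes the length of $Z$. For $B\in\mathbb{R}_{\max}^{d\times d}$, $B^+=B\oplus B^{\otimes 2}\oplus\dots\oplus B^{\otimes d}$. For a critical cycle $Z$ put $\lambda=\lambda(F)$, $U_Z=((\lambda^-\otimes F)^{\otimes l(Z)})^+$ and define $d\times d$ matrices $C_Z,S_Z,R_Z$: $(C_Z)_{ij}=(U_Z)_{ij}$ if $j$ is a node of $Z$ and $-\infty$ otherwise; $(R_Z)_{ij}=(U_Z)_{ij}$ if $i$ is a node of $Z$ and $-\infty$ otherwise; $(S_Z)_{ij}=\lambda^-\otimes F_{ij}$ if $(i,j)$ is an arc of $Z$ and $-\infty$ otherwise. $X_{\cdot i}$ denotes the $i$-th column of $X$. Discrete logarithm algorithm. Input: $A,V\in\mathbb{R}_{\max}^{m\times d}$, $F\in\mathbb{R}_{\max}^{d\times d}$. Part 0: find $\lambda=\lambda(F)$ and a critical cycle $Z$; compute $C_Z,S_Z,R_Z$. Part 1: for $t=0,1,\dots,(d-1)^2$ check if $A=V\otimes F^{\otimes t}$, and return $t$ if it is found. Part 2: for $k=0,1,\dots,l(Z)-1$ in turn, check whether there is a real number $\mu$, the same for all nodes $i$ of $Z$, such that $A_{\cdot i}$ and $V\otimes (C_Z\otimes S_Z^{\otimes k}\otimes R_Z)_{\cdot i}$ differ by the constant $\mu$ (i.e. $A_{\cdot i}=\mu\otimes V\otimes (C_Z\otimes S_Z^{\otimes k}\otimes R_Z)_{\cdot i}$) for all nodes $i$ of $Z$,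 and such that $t=\mu/\lambda(F)$ is a natural number; return the first such $t$ that is found. *)

(* Defs.v *)
From HB Require Import structures.
From mathcomp Require Import all_boot all_order all_algebra.
From mathcomp Require Import reals.

Set Implicit Arguments.
Unset Strict Implicit.
Unset Printing Implicit Defensive.

Import Order.TTheory GRing.Theory Num.Theory.
Local Open Scope ring_scope.

(** * The max-plus semiring

    [maxplus R] is a semiring whose [+] is the maximum and whose [*] is the
    addition of reals.  Pitfall: its [0] is [NegInf] and its [1] is [Fin 0].
    Consequently, on matrices over [maxplus R], [A + B], [A *m B], [A ^+ t],
    [a *: A] and [\sum] are the tropical operations, and [1] is the tropical
    identity. *)

Inductive maxplus (R : realType) : Type := NegInf | Fin of R.
Arguments NegInf {R}.
Arguments Fin {R} _.

Section MaxPlus.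
Variable R : realType.
Local Notation T := (maxplus R).

Definition maxplus_opt (x : T) : option R := if x is Fin r then Some r else None.
Definition opt_maxplus (x : option R) : T := if x is Some r then Fin r else NegInf.

Lemma maxplus_optK : cancel maxplus_opt opt_maxplus.
Proof. by case. Qed.

HB.instance Definition _ := Choice.copy T (can_type maxplus_optK).

Definition mp_add (x y : T) : T :=
  match x, y with
  | NegInf, _ => y
  | _, NegInf => x
  | Fin a, Fin b => Fin (Num.max a b)
  end.

Definition mp_mul (x y : T) : T :=
  match x, y with
  | Fin a, Fin b => Fin (a + b)
  | _, _ => NegInf
  end.

Lemma mp_addA : associative mp_add.
Proof. by move=> [|a] [|b] [|c] //=; rewrite maxA. Qed.

Lemma mp_addC : commutative mp_add.
Proof. by move=> [|a] [|b] //=; rewrite maxC. Qed.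

Lemma mp_add0 : left_id NegInf mp_add.
Proof. by case. Qed.

Lemma mp_mulA : associative mp_mul.
Proof. by move=> [|a] [|b] [|c] //=; rewrite addrA. Qed.

Lemma mp_mulC : commutative mp_mul.
Proof. by move=> [|a] [|b] //=; rewrite addrC. Qed.

Lemma mp_mul1 : left_id (Fin 0) mp_mul.
Proof. by case=> //= a; rewrite add0r. Qed.

Lemma mp_mulDl : left_distributive mp_mul mp_add.
Proof. by move=> [|a] [|b] [|c] //=; rewrite addr_maxl. Qed.

Lemma mp_mul0 : left_zero NegInf mp_mul.
Proof. by case. Qed.

Lemma mp_1neq0 : Fin 0 != NegInf :> T.
Proof. by []. Qed.

HB.instance Definition _ := GRing.isNmodule.Build T mp_addA mp_addC mp_add0.
HB.instance Definition _ := GRing.Nmodule_isComNzSemiRing.Build T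
  mp_mulA mp_mulC mp_mul1 mp_mulDl mp_mul0 mp_1neq0.

End MaxPlus.

(** * Cycles

    A cycle is the sequence of its pairwise distinct nodes in cyclic order; the
    last node is followed by the first one, so that [[:: v]] is a loop at [v]
    and the length of the cycle is [size c]. *)

Definition is_cycle d (e : rel 'I_d) (c : seq 'I_d) : bool :=
  (c != [::]) && ucycleb e c.

Definition arc_of d (c : seq 'I_d) : rel 'I_d :=
  fun i j => (i \in c) && (next c i == j).

Section Digraph.
Variables (R : realType) (d : nat) (F : 'M[maxplus R]_d).

Definition arcs : rel 'I_d := fun i j => F i j != NegInf.

Definition irreducible_mx : Prop := forall i j : 'I_d, connect arcs i j.

Definition cycle_mean (c : seq 'I_d) : maxplus R :=
  if \prod_(i <- c) F i (next c i) is Fin w then Fin (w / (size c)%:R)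
  else NegInf.

(* [\sum] is the maximum in [maxplus R], which is [NegInf] over an empty range.
   Cycles have at most [d] nodes, hence the finite index type [d.-bseq 'I_d]. *)
Definition max_cycle_mean : maxplus R :=
  \sum_(c : d.-bseq 'I_d | is_cycle arcs c) cycle_mean c.

Definition max_mean_cycle (c : seq 'I_d) : bool :=
  is_cycle arcs c && (cycle_mean c == max_cycle_mean).

Definition crit_node : pred 'I_d :=
  fun i => [exists c : d.-bseq 'I_d, max_mean_cycle c && (i \in c)].

Definition crit_arc : rel 'I_d :=
  fun i j => [exists c : d.-bseq 'I_d, max_mean_cycle c && arc_of c i j].

Definition strongly_connected_crit : Prop :=
  forall i j : 'I_d, crit_node i -> crit_node j -> connect crit_arc i j.

Definition critical_cycle (Z : seq 'I_d) : bool := is_cycle crit_arc Z.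

(* The real number [lambda(F)]; the default 0 is irrelevant when
   [max_cycle_mean] is finite. *)
Definition lam : R := if max_cycle_mean is Fin l then l else 0.

End Digraph.

(** * CSR terms *)

Definition mp_plus (R : realType) d (B : 'M[maxplus R]_d) : 'M[maxplus R]_d :=
  \sum_(1 <= k < d.+1) B ^+ k.

Section CSR.
Variables (R : realType) (d : nat) (F : 'M[maxplus R]_d) (Z : seq 'I_d).

Definition csr_U : 'M[maxplus R]_d :=
  mp_plus ((Fin (- lam F) *: F) ^+ size Z).

Definition csr_C : 'M[maxplus R]_d :=
  \matrix_(i, j) if j \in Z then csr_U i j else NegInf.

Definition csr_R : 'M[maxplus R]_d :=
  \matrix_(i, j) if i \in Z then csr_U i j else NegInf.

Definition csr_S : 'M[maxplus R]_d :=
  \matrix_(i, j) if arc_of Z i j then Fin (- lam F) * F i j else NegInf.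

End CSR.

(** * The discrete logarithm algorithm *)

Section DiscreteLog.
Variables (R : realType) (m d : nat).
Variables (A V : 'M[maxplus R]_(m, d)) (F : 'M[maxplus R]_d) (Z : seq 'I_d).

Definition part1_accepts (t : nat) : Prop := A = V *m F ^+ t.

Definition part2_accepts (k t : nat) : Prop :=
  exists mu : R,
    (forall i, i \in Z ->
       col i A = Fin mu *: (V *m col i (csr_C F Z *m csr_S F Z ^+ k *m csr_R F Z)))
    /\ mu / lam F = t%:R.

Definition part1_fails : Prop :=
  forall t, (t <= d.-1 ^ 2)%N -> ~ part1_accepts t.

(* [dlog_run o]: with [Z] the critical cycle found in Part 0, the algorithm may
   terminate with output [o] ([None] when nothing is found).  It is a relation
   because, for general inputs, [mu] need not be unique in Part 2. *)
Inductive dlog_run : option nat -> Prop :=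
| dlog_part1 t :
    (t <= d.-1 ^ 2)%N -> part1_accepts t ->
    (forall s, (s < t)%N -> ~ part1_accepts s) ->
    dlog_run (Some t)
| dlog_part2 k t :
    part1_fails -> (k < size Z)%N -> part2_accepts k t ->
    (forall k' s, (k' < k)%N -> ~ part2_accepts k' s) ->
    dlog_run (Some t)
| dlog_not_found :
    part1_fails -> (forall k s, (k < size Z)%N -> ~ part2_accepts k s) ->
    dlog_run None.

End DiscreteLog.

(* Main.v *)
(** Normalize [F] to [B] by subtracting lambda from its entries: all cycles of
    [B] have weight at most 0, and there is a potential [x] with
    [B i j <= x i - x j], with equality on the critical arcs.  Hence walking
    along [Z] costs nothing up to the potential.

    The central fact is that for a node [j] of [Z] and [t > (d - 1)^2], the
    entry [(B ^+ t) i j] is the largest weight of a walk from [i] to [j] whose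
    length is congruent to [t] modulo [l = size Z].  If [l < d], an optimal walk
    that does not repeat a pair (node, time mod [l]) has length less than
    [d * l], and is then padded with copies of [Z].  If [Z] is Hamiltonian, a
    walk is encoded by the excesses of its arcs with respect to the arcs of [Z];
    removing zero-sum parts modulo [d] leaves either at most [d - 2] excesses or
    [d - 1] equal ones, and both kinds of sequences can be executed in
    [(d - 1)^2 + 1] steps.

    Thus the CSR term agrees with [B ^+ t] in the columns of [Z].  For each row
    of [V *m B ^+ t], the sum of the entries in these columns does not decrease
    with [t], hence is constant for large [t] by periodicity.  So the constant
    [mu] found in Part 2 has to be [lambda t], and [t] is determined by
    [V *m F ^+ t]. *)

Require Import Defs.
From mathcomp Require Import all_boot all_order all_algebra.
From mathcomp Require Import reals.
From mathcomp Require Import boolp zify ring lra.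

Set Implicit Arguments.
Unset Strict Implicit.
Unset Printing Implicit Defensive.

Import Order.TTheory GRing.Theory Num.Theory.
Local Open Scope ring_scope.

(** * The order of the max-plus semiring *)

Definition mp_le (R : realType) (x y : maxplus R) : bool :=
  match x, y with
  | NegInf, _ => true
  | Fin _, NegInf => false
  | Fin a, Fin b => a <= b
  end.
Notation "x =< y" := (mp_le x y) (at level 70, no associativity).

Section Order.
Variable R : realType.
Implicit Types x y z : maxplus R.

Lemma mp_lexx x : x =< x.
Proof. by case: x => /=. Qed.

Lemma mp_le_trans y x z : x =< y -> y =< z -> x =< z.
Proof. by case: x y z => [|a] [|b] [|c] //=; exact: le_trans. Qed.

Lemma mp_le_anti x y : x =< y -> y =< x -> x = y.
Proof.
by case: x y => [|a] [|b] //= ab ba; congr Fin; apply/le_anti/andP.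
Qed.

Lemma mp_leM x x' y y' : x =< x' -> y =< y' -> x * y =< x' * y'.
Proof. by case: x x' y y' => [|a] [|a'] [|b] [|b'] //=; exact: lerD. Qed.

Lemma mp_leMr x y : 1 =< y -> x =< x * y.
Proof. by move=> y1; rewrite -{1}(mulr1 x) mp_leM ?mp_lexx. Qed.

Lemma mp_leDl x y : x =< x + y.
Proof. by case: x y => [|a] [|b] //=; rewrite ?lexx // le_max lexx. Qed.

Lemma mp_geD x y z : x =< z -> y =< z -> x + y =< z.
Proof. by case: x y z => [|a] [|b] [|c] //= ac bc; rewrite ge_max ac. Qed.

Lemma mp_finP x : reflect (exists a, x = Fin a) (x != NegInf).
Proof.
case: x => [|a]; first by rewrite eqxx; constructor; case.
by constructor; exists a.
Qed.

Lemma mp_le_fin x y : x =< y -> x != NegInf -> y != NegInf.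
Proof. by case: x y => [|a] [|b]. Qed.

Lemma mp_mul_fin x y : (x * y != NegInf) = (x != NegInf) && (y != NegInf).
Proof. by case: x y => [|a] [|b]. Qed.

Lemma mp_mulFin (a b : R) : Fin a * Fin b = Fin (a + b).
Proof. by []. Qed.

Lemma mp_mulKF (a : R) x : Fin (- a) * (Fin a * x) = x.
Proof. by rewrite mulrA mp_mulFin addNr mul1r. Qed.

Lemma mp_mulFK (a : R) x : Fin a * (Fin (- a) * x) = x.
Proof. by rewrite mulrA mp_mulFin addrN mul1r. Qed.

Lemma mp_leM2l (a : R) x y : (Fin a * x =< Fin a * y) = (x =< y).
Proof. by case: x y => [|b] [|c] //=; rewrite lerD2l. Qed.

Lemma mp_mulI (a : R) x y : Fin a * x = Fin a * y -> x = y.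
Proof. by move=> E; rewrite -(mp_mulKF a x) E mp_mulKF. Qed.

Lemma mp_exprFin (a : R) n : Fin a ^+ n = Fin (a *+ n).
Proof. by elim: n => [|n IH]; rewrite ?exprS ?IH ?mulrS. Qed.

Lemma mp_prod_le (I : Type) (r : seq I) (P : pred I) (f g : I -> maxplus R) :
  (forall i, P i -> f i =< g i) ->
  \prod_(i <- r | P i) f i =< \prod_(i <- r | P i) g i.
Proof.
move=> fg; apply: (big_ind2 (@mp_le R)) => [|x x' y y'|] //.
  exact: mp_lexx.
exact: mp_leM.
Qed.

Lemma mp_prod_fin (I : eqType) (r : seq I) (f : I -> maxplus R) :
  (forall i, i \in r -> f i != NegInf) -> \prod_(i <- r) f i != NegInf.
Proof.
move=> fin; rewrite big_seq; elim/big_rec: _ => // i x /fin fi xfin.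
by rewrite mp_mul_fin fi.
Qed.

Lemma mp_le_sum (I : eqType) (r : seq I) (P : pred I) (f : I -> maxplus R) i :
  i \in r -> P i -> f i =< \sum_(j <- r | P j) f j.
Proof. by move=> ir Pi; rewrite (big_rem i ir) /= Pi mp_leDl. Qed.

Lemma mp_sum_ge (I : Type) (r : seq I) (P : pred I) (f : I -> maxplus R) z :
  (forall i, P i -> f i =< z) -> \sum_(j <- r | P j) f j =< z.
Proof. by move=> fz; elim/big_rec: _ => // i x Pi; apply: mp_geD; exact: fz. Qed.

Lemma mp_sum_attained (I : eqType) (r : seq I) (P : pred I)
    (f : I -> maxplus R) :
  \sum_(j <- r | P j) f j != NegInf ->
  exists i, [/\ i \in r, P i & \sum_(j <- r | P j) f j = f i].
Proof.
elim: r => [|i r IH]; rewrite ?big_nil ?eqxx // big_cons.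
case: ifP => [Pi|_]; last first.
  by move=> /IH [j [jr Pj ->]]; exists j; rewrite inE jr orbT.
set S := \sum_(j <- r | P j) f j in IH *.
have [S0|/IH [j [jr Pj Sj]]] := eqVneq S NegInf.
  by rewrite S0 addr0 => _; exists i; rewrite inE eqxx.
have : f i + S = f i \/ f i + S = f j.
  rewrite Sj; case: (f i) (f j) => [|a] [|b]; try by [left|right].
  have [ba|ab] := leP b a; [left|right]; congr Fin; first exact: max_l.
  exact/max_r/ltW.
by case=> -> _; [exists i|exists j]; rewrite inE ?eqxx ?jr ?orbT.
Qed.

(** Finite factors can be cancelled: a product of dominated factors that is not smaller leaves no
    slack in any factor. This makes every arc of a cycle of weight 0 tight for the potential. *)
Lemma mp_prod_eq_le (I : eqType) (r : seq I) (f g : I -> maxplus R) :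
  (forall i, i \in r -> f i =< g i) -> (forall i, i \in r -> g i != NegInf) ->
  \prod_(i <- r) g i =< \prod_(i <- r) f i ->
  forall i, i \in r -> g i =< f i.
Proof.
move=> fg gfin le_gf i ir; rewrite !(big_rem i ir) /= in le_gf.
have sub j : j \in rem i r -> j \in r by exact: mem_rem.
have le_rem : \prod_(j <- rem i r) f j =< \prod_(j <- rem i r) g j.
  rewrite big_seq [X in _ =< X]big_seq; apply: mp_prod_le => j /sub; exact: fg.
have /mp_finP[c gc] : \prod_(j <- rem i r) g j != NegInf.
  by apply: mp_prod_fin => j /sub /gfin.
have := mp_le_trans le_gf (mp_leM (mp_lexx (f i)) le_rem).
by rewrite gc !(mulrC _ (Fin c)) mp_leM2l.
Qed.

End Order.
#[global] Hint Resolve mp_lexx : core.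
Arguments mp_le : simpl never.

(** * Walks *)

Section Products.
Variable R : realType.

Lemma mulmx_le (m n q : nat) (A A' : 'M[maxplus R]_(m, n))
    (B B' : 'M[maxplus R]_(n, q)) :
  (forall i k, A i k =< A' i k) -> (forall k j, B k j =< B' k j) ->
  forall i j, (A *m B) i j =< (A' *m B') i j.
Proof.
move=> AA BB i j; rewrite !mxE; apply: mp_sum_ge => k _.
have := mp_le_sum (P := predT) (fun k => A' i k * B' k j) (mem_index_enum k) isT.
by apply: mp_le_trans; exact: mp_leM.
Qed.

Lemma mulmx_entry_le (m n q : nat) (A : 'M[maxplus R]_(m, n))
    (B : 'M[maxplus R]_(n, q)) i k j : A i k * B k j =< (A *m B) i j.
Proof.
rewrite mxE.
exact: (mp_le_sum (P := predT) (fun k => A i k * B k j) (mem_index_enum k)).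
Qed.

End Products.

Section Walks.
Variables (R : realType) (d : nat).
Implicit Types (A B : 'M[maxplus R]_d) (i j : 'I_d) (p : seq 'I_d).

Lemma expmx_entry_le A s t i k j :
  (A ^+ s) i k * (A ^+ t) k j =< (A ^+ (s + t)) i j.
Proof. by rewrite exprD; exact: mulmx_entry_le. Qed.

Lemma expmx_le A B :
  (forall i j, A i j =< B i j) -> forall k i j, (A ^+ k) i j =< (B ^+ k) i j.
Proof.
move=> AB; elim=> [|k IH] i j; first by rewrite !expr0.
by rewrite !exprS; apply: mulmx_le.
Qed.

Lemma one_mx_diag i : (1 : 'M[maxplus R]_d) i i = 1.
Proof. by rewrite mxE eqxx. Qed.

Fixpoint walk_weight A i p : maxplus R :=
  if p is j :: p' then A i j * walk_weight A j p' else 1.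

Lemma walk_weight_cat A i p q :
  walk_weight A i (p ++ q) = walk_weight A i p * walk_weight A (last i p) q.
Proof. by elim: p i => [|j p IH] i /=; rewrite ?mul1r // IH mulrA. Qed.

Lemma walk_weight_le A i p : walk_weight A i p =< (A ^+ size p) i (last i p).
Proof.
elim: p i => [|j p IH] i /=; first by rewrite expr0 one_mx_diag mp_lexx.
rewrite exprS; apply: (mp_le_trans _ (mulmx_entry_le _ _ _ j _)).
exact: mp_leM.
Qed.

Lemma expmx_walk A t i j : (A ^+ t) i j != NegInf ->
  exists p, [/\ size p = t, last i p = j & (A ^+ t) i j = walk_weight A i p].
Proof.
elim: t i => [|t IH] i.
  rewrite expr0 mxE; have [<- _|ij] := eqVneq i j; last by case/eqP.
  by exists [::]; rewrite /= mulr1n.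
rewrite exprS -mulmxE mxE => Sfin.
have [k [_ _ E]] := mp_sum_attained Sfin.
move: Sfin; rewrite E mp_mul_fin => /andP[_ /IH[p [sp lp Ep]]].
by exists (k :: p); split; rewrite //= ?sp ?lp // -Ep.
Qed.

(* [q] residues for the time and [d] nodes: a walk of length at least [d * q]
   is at the same node at two times that agree modulo [q]. *)
Lemma expmx_reduce A q : (0 < q)%N -> (forall k i, (A ^+ k) i i =< 1) ->
  forall t i j, exists t', [/\ (t' < d * q)%N, t' = t %[mod q] &
    (A ^+ t) i j =< (A ^+ t') i j].
Proof.
move=> q0 closed t i j; elim/ltn_ind: t => t IH.
have d0 : (0 < d)%N by case: d i {A closed j IH} => [[]|].
have [|tdq] := ltnP t (d * q)%N; first by exists t.
have [->|/expmx_walk[p [sp lp Ep]]] := eqVneq ((A ^+ t) i j) NegInf.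
  exists (t %% q)%N; rewrite modn_mod; split=> //.
  by apply: leq_trans (ltn_pmod t q0) _; rewrite leq_pmull.
pose f (s : 'I_t.+1) : 'I_d * 'I_q :=
  (nth i (i :: p) s, Ordinal (ltn_pmod s q0)).
have /injectivePn[s [s' ss' [Enth Emod]]] : ~~ injectiveb f.
  apply/negP => /injectiveP /leq_card.
  by rewrite card_prod !card_ord; lia.
wlog lt_ss' : s s' ss' Enth Emod / (s < s')%N.
  move=> W; have [|lt|E] := ltngtP s s'; first exact: W.
  - by apply: (W s' s) => //; rewrite eq_sym.
  - by move: ss'; rewrite (val_inj E) eqxx.
have s't : (s' <= t)%N by have := ltn_ord s'.
have lastT u : (u <= t)%N -> last i (take u p) = nth i (i :: p) u.
  move=> ut; rewrite (last_nth i) size_takel ?sp //.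
  case: u ut => //= u ut; by rewrite nth_take.
set v := nth i (i :: p) s in Enth.
have lv : last i (take s p) = v by rewrite lastT //; lia.
have lv' : last i (take s' p) = v by rewrite lastT // -Enth.
pose mid := drop s (take s' p).
have Ep1 : take s' p = take s p ++ mid.
  by rewrite -{1}(cat_take_drop s (take s' p)) take_takel // ltnW.
have lm : last v mid = v by move: lv'; rewrite Ep1 last_cat lv.
have lD : last v (drop s' p) = j.
  by rewrite -lp -{2}(cat_take_drop s' p) last_cat lv'.
(* The closed part between the times [s] and [s'] has nonpositive weight, so cutting it out does not
   lower the weight. *)
have Ew : (A ^+ t) i j =< (A ^+ (s + (t - s'))) i j.
  rewrite Ep -{1}(cat_take_drop s' p) walk_weight_cat lv' Ep1 walk_weight_cat lv.
  have midle : walk_weight A v mid =< 1.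
    by apply: mp_le_trans (walk_weight_le _ _ _) _; rewrite lm closed.
  apply: (mp_le_trans _ (expmx_entry_le _ _ _ _ v _)).
  have h1 := walk_weight_le A i (take s p).
  have h2 := walk_weight_le A v (drop s' p).
  rewrite lv size_takel in h1; last by lia.
  rewrite lD size_drop sp in h2.
  by apply: mp_leM => //; rewrite -[X in _ =< X]mulr1; apply: mp_leM.
have [|t' [lt' Et' le']] := IH (s + (t - s'))%N; first by lia.
exists t'; split=> //; last exact: mp_le_trans Ew le'.
rewrite Et'; apply/eqP; rewrite -(eqn_modDr s').
have -> : (s + (t - s') + s' = t + s)%N by lia.
by rewrite eqn_modDl; apply/eqP.
Qed.

End Walks.

(** * Zero-sum free sequences *)

Section ZeroSum.
Variables (R : realType) (n : nat) (f : nat -> maxplus R).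
Hypotheses (n_gt0 : (0 < n)%N) (f_le1 : forall e, f e =< 1).
Implicit Types s : seq nat.

(** In the application the sum modulo [n] fixes the endpoint of the encoded walk, and the product
    bounds its weight. *)
Definition shortens s s' :=
  [/\ {subset s' <= s}, sumn s' = sumn s %[mod n] &
      \prod_(e <- s) f e =< \prod_(e <- s') f e].

Lemma shortens_trans s1 s2 s3 :
  shortens s1 s2 -> shortens s2 s3 -> shortens s1 s3.
Proof.
move=> [sub12 E12 le12] [sub23 E23 le23]; split; first by move=> e /sub23/sub12.
  by rewrite E23.
exact: mp_le_trans le12 le23.
Qed.

Lemma perm_shortens s s' : perm_eq s s' -> shortens s s'.
Proof.
move=> ss'; split; first by move=> e; rewrite (perm_mem ss').
  by rewrite (perm_sumn ss').
by rewrite (perm_big _ ss') /= mp_lexx.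
Qed.

Definition prefix_sum s (u : 'I_(size s).+1) : 'I_n :=
  Ordinal (ltn_pmod (sumn (take u s)) n_gt0).

(** The block between two equal prefix sums has sum zero modulo [n]; deleting it cannot decrease the
    product because [f] is at most [1]. *)
Lemma shorten_or_inj s :
  (exists s', shortens s s' /\ (size s' < size s)%N) \/
  injective (@prefix_sum s).
Proof.
have [/injectiveP|/injectivePn[u [v [uv /(congr1 val)/= E]]]] :=
  boolP (injectiveb (@prefix_sum s)); first by right.
left; wlog {uv} uv : u v E / (u < v)%N.
  move=> W; have [lt|lt|/val_inj uv'] := ltngtP u v; first exact: W lt.
    exact: W lt.
  by rewrite uv' eqxx in uv.
have vs : (v <= size s)%N by rewrite -ltnS.
have Es : s = take u s ++ drop u (take v s) ++ drop v s.
  rewrite catA -[X in X ++ drop u _](take_takel s (ltnW uv)).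
  by rewrite cat_take_drop cat_take_drop.
exists (take u s ++ drop v s); split; last first.
  by rewrite size_cat size_takel ?size_drop; lia.
split.
- by move=> e; rewrite mem_cat => /orP[/mem_take|/mem_drop].
- rewrite -[in RHS](cat_take_drop v s) !sumn_cat.
  by apply/eqP; rewrite eqn_modDr E.
rewrite {1}Es !big_cat /= mp_leM // -[X in _ =< X]mul1r mp_leM //.
elim/big_rec: _ => // e x _ x1; rewrite -[1]mul1r; exact: mp_leM.
Qed.

(* A zero-sum free sequence over Z/n has length at most n - 1, with equality
   only for a constant sequence: otherwise its prefix sums cover Z/n, and so do
   those of the sequence with two distinct elements x, y in front, in either
   order; but the prefix sum y of one order is missed by the other. *)
Lemma shorten_zero_sum s : (forall e, e \in s -> 0 < e < n)%N ->
  exists s', shortens s s' /\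
    ((size s' <= n - 2)%N \/ exists e, s' = nseq n.-1 e).
Proof.
have [k] := ubnP (size s); elim: k s => // k IH s sk sn.
have [small|big] := leqP (size s) (n - 2).
  by exists s; split; [exact: perm_shortens | left].
have via s1 : perm_eq s s1 ->
    (exists s', shortens s1 s' /\ (size s' < size s1)%N) ->
    exists s', shortens s s' /\
      ((size s' <= n - 2)%N \/ exists e, s' = nseq n.-1 e).
  move=> ss1 [s2 [s12 size2]]; have {}s12 := shortens_trans (perm_shortens ss1) s12.
  have [] := IH s2.
  - by apply: leq_trans size2 _; rewrite -(perm_size ss1) -ltnS.
  - by case: s12 => sub _ _ e /sub/sn.
  by move=> s3 [s23 ?]; exists s3; split=> //; exact: shortens_trans s12 s23.
have [/via|inj] := shorten_or_inj s; first exact.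
(* Counting the empty prefix, [size s + 1] distinct residues modulo [n] occur. *)
have size_s : size s = n.-1.
  have := leq_card _ inj; rewrite !card_ord.
  by lia.
case: s => [|x s] in sk sn big via inj size_s *; first by [].
have [/all_pred1P Es|/allPn[y ys]] := boolP (all (pred1 x) s).
  exists (x :: s); split; first exact: perm_shortens.
  by right; exists x; rewrite -size_s {1}Es.
rewrite /= => yx; pose r := rem y s.
have p1 : perm_eq (x :: s) [:: x, y & r] by rewrite perm_cons perm_to_rem.
have p2 : perm_eq (x :: s) [:: y, x & r].
  apply: perm_trans p1 _; rewrite -[_ :: _]/([:: x] ++ [:: y] ++ r).
  by rewrite perm_catCA.
have [/(via _ p1)|inj1] := shorten_or_inj [:: x, y & r]; first exact.
have [/(via _ p2)|inj2] := shorten_or_inj [:: y, x & r]; first exact.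
have yn : (0 < y < n)%N by apply: sn; rewrite inE ys orbT.
have xn : (0 < x < n)%N by apply: sn; rewrite inE eqxx.
have : Ordinal (ltn_pmod y n_gt0) \in codom (@prefix_sum [:: x, y & r]).
  apply: inj_card_onto => //; rewrite !card_ord -(perm_size p1) size_s.
  by rewrite prednK.
case/codomP=> -[u /= ult] /(congr1 val) /=.
(* The empty prefix would give [y = 0], the prefix of length 1 would give [x = y]. A longer prefix
   has the same sum in both orders, so in the order starting with [y] it collides with the prefix of
   length 1. *)
case: u ult => [|[|u]] ult /=.
- by rewrite mod0n modn_small //; lia.
- by rewrite ?take0 ?addn0 !modn_small //; move/eqP: yx; lia.
move=> E; have /(congr1 val) : Ordinal (ult : (u.+2 < (size [:: y, x & r]).+1)%N)
   = Ordinal (isT : (1 < (size [:: y, x & r]).+1)%N).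
  by apply: inj2; apply: val_inj; rewrite /= ?take0 ?addn0 E addnCA.
by [].
Qed.

End ZeroSum.

(** * Columns of a cycle of weight 0 *)

Section CriticalColumns.
(** [N] stands for the normalized matrix conjugated by a potential, and [z] runs periodically
    through the cycle, whose arcs have weight 0. *)
Variables (R : realType) (d l : nat) (N : 'M[maxplus R]_d) (z : nat -> 'I_d).
Hypotheses (l_gt0 : (0 < l)%N) (z_mod : forall p, z (p %% l) = z p).
Hypotheses (N_le1 : forall i j, N i j =< 1)
  (N_z : forall p, 1 =< N (z p) (z p.+1)).

Lemma z_eqmod p q : p = q %[mod l] -> z p = z q.
Proof. by move=> E; rewrite -z_mod E z_mod. Qed.

Lemma expmx_le1 k i j : (N ^+ k) i j =< 1.
Proof.
elim: k i j => [|k IH] i j.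
  by rewrite expr0 mxE; case: (i == j); rewrite // mulr1n mp_lexx.
rewrite exprS -mulmxE mxE; apply: mp_sum_ge => x _.
by rewrite -[1](mulr1 1); exact: mp_leM.
Qed.

Lemma expmx_z k p : 1 =< (N ^+ k) (z p) (z (p + k)).
Proof.
elim: k p => [|k IH] p; first by rewrite expr0 addn0 one_mx_diag mp_lexx.
rewrite exprS; apply: (mp_le_trans _ (mulmx_entry_le _ _ _ (z p.+1) _)).
by rewrite -[1](mulr1 1) -addSnnS; exact: mp_leM.
Qed.

Lemma expmx_pad s t i p : (s <= t)%N ->
  (N ^+ s) i (z p) =< (N ^+ t) i (z (p + (t - s))).
Proof.
move=> st; rewrite -{1}(subnKC st).
apply: (mp_le_trans _ (expmx_entry_le _ _ _ _ (z p) _)).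
exact/mp_leMr/expmx_z.
Qed.

Lemma expmx_critical_short s t i p : (l < d)%N -> ((d.-1) ^ 2 < t)%N ->
  s = t %[mod l] -> (N ^+ s) i (z p) =< (N ^+ t) i (z p).
Proof.
move=> ld dt st.
have [s' [s'dl s's le_s']] :=
  expmx_reduce l_gt0 (fun k i => expmx_le1 k i i) s i (z p).
apply: mp_le_trans le_s' _.
(* If [s' > t], congruence gives [s' >= t + l], hence [(d - 1)^2 + 1 + l < d * l], which is
   impossible for [l <= d - 1]. *)
have s't : (s' <= t)%N.
  rewrite leqNgt; apply/negP => ts'.
  have : (l %| s' - t)%N by rewrite -eqn_mod_dvd ?(ltnW ts') // s's st.
  by move=> /dvdnP[[|c] Ec]; nia.
have zE : z (p + (t - s')) = z p.
  apply: z_eqmod; apply/eqP; rewrite -[X in _ == X %[mod _]]addn0.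
  by rewrite eqn_modDl mod0n -/(dvdn _ _) -eqn_mod_dvd // s's st.
by rewrite -[in X in _ =< X]zE; exact: expmx_pad.
Qed.

(** * Hamiltonian cycles: walks encoded by excesses *)

Section Hamiltonian.
Hypotheses (ld : l = d) (z_surj : forall i, exists p, i = z p).

(* The excess of the arc (z p, z (p + 1 + e)) is [e]: on the Hamiltonian cycle
   it takes the place of an arc of excess 0. *)
Definition best_arc e : maxplus R := \sum_(p < l) N (z p) (z (p + 1 + e)).

Lemma best_arc_ge e p : N (z p) (z (p + 1 + e)) =< best_arc e.
Proof.
have := mp_le_sum (P := predT) (fun p : 'I_l => N (z p) (z (p + 1 + e)))
  (mem_index_enum (Ordinal (ltn_pmod p l_gt0))) isT.
rewrite /= z_mod; congr (N _ _ =< _); apply: z_eqmod.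
by rewrite -!addnA modnDml.
Qed.

Lemma best_arc_attained e : exists p, best_arc e =< N (z p) (z (p + 1 + e)).
Proof.
have [->|/mp_sum_attained[p [_ _ E]]] := eqVneq (best_arc e) NegInf.
  by exists 0%N.
by exists (val p); rewrite -E mp_lexx.
Qed.

Lemma best_arc_le1 e : best_arc e =< 1.
Proof. exact: mp_sum_ge. Qed.

(** Every arc has an excess because the cycle meets all nodes. Zero excesses are dropped, which is
    harmless as weights are nonpositive; the sum of the others is the displacement relative to [T]
    steps along the cycle. *)
Lemma walk_excesses T p q : (N ^+ T) (z p) (z q) != NegInf ->
  exists s, [/\ forall e, e \in s -> (0 < e < l)%N,
      (N ^+ T) (z p) (z q) =< \prod_(e <- s) best_arc e &
      z (p + T + sumn s) = z q].
Proof.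
elim: T p => [|T IH] p.
  rewrite expr0 mxE; have [E _|_] := eqVneq (z p) (z q); last by case/eqP.
  by exists [::]; rewrite /= !addn0 big_nil mulr1n mp_lexx.
rewrite exprS -mulmxE mxE => Sfin.
have [x [_ _ E]] := mp_sum_attained Sfin.
move: Sfin; rewrite E mp_mul_fin => /andP[_ fin].
have [r xr] := z_surj x.
pose e := ((r + (l - (p + 1) %% l)) %% l)%N.
have xe : x = z (p + 1 + e).
  rewrite xr; apply: z_eqmod; rewrite /e modnDmr -modnDml addnCA.
  by rewrite subnKC ?modnDr // ltnW // ltn_pmod.
rewrite xe in fin *; have [s [s_ok le_s zs]] := IH _ fin.
have [e0|e_gt0] := posnP e; last first.
  exists (e :: s); split.
  - move=> e'; rewrite inE => /orP[/eqP->|/s_ok//].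
    by rewrite e_gt0 ltn_pmod.
  - by rewrite big_cons; apply: mp_leM => //; exact: best_arc_ge.
  - by rewrite -zs /=; congr z; lia.
exists s; split=> //; last by rewrite -zs; congr z; lia.
by rewrite -[X in _ =< X]mul1r; exact: mp_leM.
Qed.

(** During one turn the walk passes the tail of a best arc of excess [e], takes this arc instead of
    the cycle arc, and follows the cycle otherwise. *)
Lemma exec_arc e p : best_arc e =< (N ^+ l) (z p) (z (p + l + e)).
Proof.
have [a le_a] := best_arc_attained e; apply: mp_le_trans le_a _.
(* The number of steps along the cycle from [z p] to [z a]. *)
pose x := ((a + (l - p %% l)) %% l)%N.
have xl : (x < l)%N by rewrite ltn_pmod.
have pxa : p + x = a %[mod l].
  rewrite /x modnDmr -modnDml addnCA.
  by rewrite subnKC ?modnDr // ltnW // ltn_pmod.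
have -> : (l = x + (1 + (l - x.+1)))%N by lia.
apply: (mp_le_trans _ (expmx_entry_le _ _ _ _ (z (p + x)) _)).
rewrite -[X in X =< _]mul1r; apply: mp_leM; first exact: expmx_z.
apply: (mp_le_trans _ (expmx_entry_le _ _ _ _ (z (p + x + 1 + e)) _)).
rewrite expr1 -[X in X =< _]mulr1; apply: mp_leM.
  rewrite (z_eqmod pxa) (_ : z (a + 1 + e) = z (p + x + 1 + e)) ?mp_lexx //.
  by apply: z_eqmod; rewrite -!addnA -modnDml -pxa modnDml !addnA.
have -> : (p + (x + (1 + (l - x.+1))) + e = p + x + 1 + e + (l - x.+1))%N by lia.
exact: expmx_z.
Qed.

Lemma exec_arcs s p :
  \prod_(e <- s) best_arc e =<
  (N ^+ (l * size s)) (z p) (z (p + l * size s + sumn s)).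
Proof.
elim: s p => [|e s IH] p.
  by rewrite big_nil muln0 expr0 !addn0 one_mx_diag mp_lexx.
rewrite big_cons mulnS.
apply: (mp_le_trans _ (expmx_entry_le _ _ _ _ (z (p + l + e)) _)).
apply: mp_leM; first exact: exec_arc.
apply: mp_le_trans (IH (p + l + e)%N) _ => /=.
have -> : (p + l + e + l * size s + sumn s
  = p + (l + l * size s) + (e + sumn s))%N by lia.
exact: mp_lexx.
Qed.

(* Going back from the head of an arc of excess [e] to its tail along the
   Hamiltonian cycle takes only [l - 1 - e] steps. *)
Lemma exec_same_arc e k p : (e < l)%N ->
  best_arc e ^+ k.+1 =< (N ^+ (l.-1 + k * (l - e) + 1)) (z p)
    (z (p + (l.-1 + k * (l - e) + 1) + e * k.+1)).
Proof.
move=> el; have [a le_a] := best_arc_attained e.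
(* Each of the first [k] uses of the arc costs [l - e] steps, the return to [z a] included; the last
   use needs no return. *)
have repeat_a : best_arc e ^+ k.+1 =<
    (N ^+ (k * (l - e) + 1)) (z a) (z (a + (k * (l - e) + 1) + e * k.+1)).
  elim: k => [|k IH].
    by rewrite expr1 mul0n add0n expr1 muln1.
  have -> : (k.+1 * (l - e) + 1 = (1 + (l - e.+1)) + (k * (l - e) + 1))%N by lia.
  rewrite exprS; apply: (mp_le_trans _ (expmx_entry_le _ _ _ _ (z (a + l)) _)).
  apply: mp_leM; last first.
    have -> : z (a + l) = z a by apply: z_eqmod; rewrite modnDr.
    have -> // : z (a + (1 + (l - e.+1) + (k * (l - e) + 1)) + e * k.+2)
      = z (a + (k * (l - e) + 1) + e * k.+1).
    apply: z_eqmod; rewrite -[RHS]modnDr; congr (_ %% _)%N; nia.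
  apply: (mp_le_trans _ (expmx_entry_le _ _ _ _ (z (a + 1 + e)) _)).
  rewrite expr1 -[X in X =< _]mulr1; apply: mp_leM => //.
  have -> : (a + l = a + 1 + e + (l - e.+1))%N by lia.
  exact: expmx_z.
(* Reaching [z a] takes [x <= l - 1] steps; the remaining [l - 1 - x] are spent on the cycle at the
   end. *)
pose x := ((a + (l - p %% l)) %% l)%N.
have xl : (x < l)%N by rewrite ltn_pmod.
have pxa : p + x = a %[mod l].
  rewrite /x modnDmr -modnDml addnCA.
  by rewrite subnKC ?modnDr // ltnW // ltn_pmod.
set w := (k * (l - e) + 1)%N in repeat_a *.
have -> : (l.-1 + k * (l - e) + 1 = x + w + (l.-1 - x))%N by rewrite /w; lia.
apply: (mp_le_trans _ (expmx_entry_le _ _ _ _ (z (p + x + w + e * k.+1)) _)).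
have -> : (p + (x + w + (l.-1 - x)) + e * k.+1
  = p + x + w + e * k.+1 + (l.-1 - x))%N by lia.
rewrite -[X in X =< _]mulr1; apply: mp_leM; last exact: expmx_z.
apply: (mp_le_trans _ (expmx_entry_le _ _ _ _ (z (p + x)) _)).
rewrite -[X in X =< _]mul1r; apply: mp_leM; first exact: expmx_z.
rewrite (z_eqmod pxa).
have -> // : z (p + x + w + e * k.+1) = z (a + w + e * k.+1).
by apply: z_eqmod; rewrite -!addnA addnA -modnDml pxa modnDml.
Qed.

Lemma expmx_critical_long s t i j : ((d.-1) ^ 2 < t)%N ->
  s = t %[mod l] -> (N ^+ s) i j =< (N ^+ t) i j.
Proof.
move=> dt st; have [p ->] := z_surj i; have [q ->] := z_surj j.
have [->//|fin] := eqVneq ((N ^+ s) (z p) (z q)) NegInf.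
have [es [es_ok le_es zes]] := walk_excesses fin.
have [es' [[sub sum_es' le_es'] es'_short]] :=
  shorten_zero_sum l_gt0 best_arc_le1 es_ok.
apply: mp_le_trans le_es (mp_le_trans le_es' _).
have -> : z q = z (p + t + sumn es').
  rewrite -zes; apply: z_eqmod; rewrite -modnDmr -sum_es' modnDmr.
  by apply/eqP; rewrite -!addnA eqn_modDl eqn_modDr st.
have [short|notshort] := leqP (size es') (l - 2).
  (* One turn per excess suffices here, since [l * (l - 2) <= (l - 1)^2]. *)
  have le_t : (l * size es' <= t)%N by rewrite -ld in dt; nia.
  apply: mp_le_trans (exec_arcs es' p) (mp_le_trans (expmx_pad _ _ le_t) _).
  have -> : (p + l * size es' + sumn es' + (t - l * size es')
    = p + t + sumn es')%N by lia.
  exact: mp_lexx.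
case: es'_short => [|[e Ees']]; first by rewrite leqNgt notshort.
have l_gt1 : (1 < l)%N by move: notshort; rewrite Ees' size_nseq; lia.
have /es_ok e_ok : e \in es.
  by apply: sub; rewrite Ees' mem_nseq eqxx; lia.
(* The length for [l - 1] uses of the same arc; [e >= 1] bounds it by [(l - 1)^2 + 1]. *)
pose w := (l.-1 + (l - 2) * (l - e) + 1)%N.
have le_t : (w <= t)%N by rewrite /w -ld in dt *; nia.
have prod_e : \prod_(e <- es') best_arc e = best_arc e ^+ (l - 2).+1.
  rewrite Ees' big_nseq; have -> : (l - 2).+1 = l.-1 by lia.
  by rewrite -Monoid.iteropE; elim: l.-1 => //= k ->; rewrite exprS.
have sum_e : sumn es' = (e * (l - 2).+1)%N.
  by rewrite Ees' sumn_nseq; congr (_ * _)%N; lia.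
rewrite prod_e sum_e.
have el : (e < l)%N by case/andP: e_ok.
apply: mp_le_trans (exec_same_arc (l - 2) p el) _.
apply: mp_le_trans (expmx_pad _ _ le_t) _; rewrite -/w.
have -> : (p + w + e * (l - 2).+1 + (t - w) = p + t + e * (l - 2).+1)%N by lia.
exact: mp_lexx.
Qed.

End Hamiltonian.

End CriticalColumns.

(** * Cycles and potentials *)

Section Cycles.
Variables (R : realType) (d : nat).
Implicit Types (A : 'M[maxplus R]_d) (i j : 'I_d) (p c : seq 'I_d).

Lemma prod_next_at A i j p : uniq (i :: p) ->
  \prod_(x <- i :: p) A x (next_at x j i p) = walk_weight A i (rcons p j).
Proof.
elim: p i => [|k p IH] i; first by rewrite big_seq1 /= eqxx mulr1.
move=> /= /andP[ip up]; rewrite big_cons /= eqxx -IH //; congr (_ * _).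
rewrite big_seq [in RHS]big_seq; apply: eq_bigr => x xp.
by case: eqP xp ip => // -> ->.
Qed.

Lemma prod_next A i p : uniq (i :: p) ->
  \prod_(x <- i :: p) A x (next (i :: p) x) = walk_weight A i (rcons p i).
Proof. exact: prod_next_at. Qed.

Definition cycles_le1 A :=
  forall c, uniq c -> \prod_(i <- c) A i (next c i) =< 1.

(** The tail is shortened first. If [i] recurs in it, the part leading back to [i] is a simple cycle
    of nonpositive weight and is dropped. *)
Lemma walk_shorten A i p : cycles_le1 A ->
  exists p', [/\ uniq (i :: p'), last i p' = last i p &
    walk_weight A i p =< walk_weight A i p'].
Proof.
move=> cyc; elim: p i => [|j p IH] i; first by exists [::]; rewrite mp_lexx.
have [p' [up' lp' le']] := IH j.
have step : walk_weight A i (j :: p) =< walk_weight A i (j :: p').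
  exact: mp_leM.
have lj : last i (j :: p') = last i (j :: p) by [].
have [|ip] := boolP (i \in j :: p'); last first.
  by exists (j :: p'); split=> //; rewrite cons_uniq ip.
move: step lj up'; move: (j :: p') => q step lq uq iq.
case/splitPr: iq step lq uq => p1 p2 step lq uq.
move: (uq); rewrite cat_uniq => /and3P[u1 /hasPn /= d12 u2].
exists p2; split=> //; first by rewrite -[RHS]lq last_cat.
apply: mp_le_trans step _; rewrite -cat_rcons walk_weight_cat last_rcons.
have u1' : uniq (i :: p1).
  by rewrite /= u1 andbT; exact: d12 (mem_head i p2).
rewrite -[X in _ =< X]mul1r; apply: mp_leM => //.
by rewrite -prod_next // cyc.
Qed.

(** A closed walk shortens to a simple path from [i] to [i], which is empty. *)
Lemma closed_walks_le1 A : cycles_le1 A -> forall k i, (A ^+ k) i i =< 1.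
Proof.
move=> cyc k i; have [->//|/expmx_walk[p [_ lp ->]]] := eqVneq ((A ^+ k) i i) NegInf.
have [p' [/= /andP[ip _] lp' le']] := walk_shorten i p cyc.
case: p' ip lp' le' => //= j p' ip lp' _.
by move: ip; rewrite -lp -lp' mem_last.
Qed.

Definition potential_mx (x : 'I_d -> R) : 'M[maxplus R]_d :=
  \matrix_(i, j) Fin (x i - x j).

Lemma walk_weight_potential (x : 'I_d -> R) i p :
  walk_weight (potential_mx x) i p = Fin (x i - x (last i p)).
Proof.
elim: p i => [|j p IH] i /=; first by rewrite subrr.
by rewrite IH mxE mp_mulFin addrA subrK.
Qed.

Lemma prod_next_potential (x : 'I_d -> R) c : uniq c ->
  \prod_(i <- c) potential_mx x i (next c i) = 1.
Proof.
case: c => [|i p] up; first by rewrite big_nil.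
by rewrite prod_next // walk_weight_potential last_rcons subrr.
Qed.

(** The potential of [i] is the largest weight of a walk from [i] to a fixed node [k]:
    irreducibility makes it finite, and prepending an arc gives the inequality. *)
Lemma potential_exists A : cycles_le1 A -> (forall i j, connect (arcs A) i j) ->
  exists x, forall i j, A i j =< potential_mx x i j.
Proof.
move=> cyc irr; have [d0|d_gt0] := posnP d.
  by exists (fun=> 0) => i; exfalso; move: (ltn_ord i); rewrite {2}d0.
pose k := Ordinal d_gt0; pose X i := \sum_(t < d) (A ^+ t) i k.
(* With modulus 1, [expmx_reduce] shows that lengths below [d] suffice. *)
have leX t i : (A ^+ t) i k =< X i.
  have [t' [t'd _ le_t']] := expmx_reduce (ltn0Sn 0) (closed_walks_le1 cyc) t i k.
  rewrite muln1 in t'd; apply: mp_le_trans le_t' _.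
  exact: (mp_le_sum (P := predT) (fun t : 'I_d => (A ^+ t) i k)
    (mem_index_enum (Ordinal t'd)) isT).
have Xfin i : X i != NegInf.
  have /connectP[p pth lp] := irr i k.
  have : walk_weight A i p != NegInf.
    elim: p i pth {lp} => [|j p IH] i //= /andP[ij pth].
    by rewrite mp_mul_fin IH // andbT.
  move=> fin; apply: mp_le_fin fin; apply: mp_le_trans (walk_weight_le _ _ _) _.
  by rewrite -lp; exact: leX.
exists (fun i => odflt 0 (maxplus_opt (X i))) => i j; rewrite mxE.
have : A i j * X j =< X i.
  rewrite /X big_distrr /=; apply: mp_sum_ge => t _.
  apply: mp_le_trans (leX t.+1 i); rewrite exprS; exact: mulmx_entry_le.
case: (X i) (X j) (Xfin i) (Xfin j) => [|a] [|b] //= _ _.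
by case: (A i j) => //= c; rewrite /mp_le lerBrDr.
Qed.

End Cycles.

(** * Normalization by the maximum cycle mean *)

Section Normalization.
Variables (R : realType) (d : nat) (F : 'M[maxplus R]_d).
Hypothesis lam_finite : max_cycle_mean F != NegInf.

Definition normalized_mx : 'M[maxplus R]_d := Fin (- lam F) *: F.
Local Notation B := normalized_mx.

Lemma max_cycle_meanE : max_cycle_mean F = Fin (lam F).
Proof. by rewrite /lam; case: max_cycle_mean lam_finite. Qed.

Lemma normalizedE i j : F i j = Fin (lam F) * B i j.
Proof. by rewrite mxE mp_mulFK. Qed.

Lemma expmx_normalized t i j : (F ^+ t) i j = Fin (lam F *+ t) * (B ^+ t) i j.
Proof.
elim: t i j => [|t IH] i j; first by rewrite !expr0 mulr0n mul1r.
rewrite !exprS -!mulmxE mxE [in RHS]mxE big_distrr /=.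
apply: eq_bigr => k _; rewrite IH normalizedE mulrACA; congr (_ * _).
by rewrite mp_mulFin mulrS.
Qed.

Lemma prod_normalized (c : seq 'I_d) (g : 'I_d -> 'I_d) :
  \prod_(i <- c) F i (g i) = Fin (lam F *+ size c) * \prod_(i <- c) B i (g i).
Proof.
elim: c => [|i c IH]; first by rewrite !big_nil mulr0n mulr1.
rewrite !big_cons IH normalizedE mulrACA; congr (_ * _).
by rewrite mp_mulFin mulrS.
Qed.

Lemma cycle_mean_normalized c : c != [::] ->
  cycle_mean F c = Fin (lam F) *
    (if \prod_(i <- c) B i (next c i) is Fin w then Fin (w / (size c)%:R)
     else NegInf).
Proof.
move=> c0; rewrite /cycle_mean prod_normalized.
case: (\prod_(i <- c) B i (next c i)) => [|w] //; congr Fin.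
have size0 : (size c)%:R != 0 :> R by rewrite pnatr_eq0 size_eq0.
by rewrite mulrDl -(mulr_natr (lam F)) mulfK.
Qed.

Lemma cycles_normalized_le1 : cycles_le1 B.
Proof.
move=> c uc; have [->|fin] := eqVneq (\prod_(i <- c) B i (next c i)) NegInf => //.
have [c0|c_neq0] := eqVneq c [::]; first by rewrite c0 big_nil mp_lexx.
have cyc : is_cycle (arcs F) c.
  rewrite /is_cycle c_neq0 /ucycleb uc andbT; apply: cycle_from_next => // x xc.
  move: fin; rewrite (big_rem x xc) /= mp_mul_fin => /andP[+ _].
  by rewrite mxE mp_mul_fin => /andP[].
have sz : (size c <= d)%N.
  by rewrite -(card_uniqP uc) (leq_trans (max_card _)) ?card_ord.
have := mp_le_sum (P := fun c : d.-bseq 'I_d => is_cycle (arcs F) c)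
  (fun c : d.-bseq 'I_d => cycle_mean F c) (mem_index_enum (Bseq sz)) cyc.
rewrite -/(max_cycle_mean F) max_cycle_meanE cycle_mean_normalized //=.
case: (\prod_(i <- c) B i (next c i)) => [|w] //; rewrite /mp_le /=.
have size_gt0 : 0 < (size c)%:R :> R by rewrite ltr0n lt0n size_eq0.
by rewrite gerDl pmulr_lle0 ?invr_gt0.
Qed.

Lemma prod_max_mean_cycle c : max_mean_cycle F c ->
  \prod_(i <- c) B i (next c i) = 1.
Proof.
case/andP=> /andP[c0 _] /eqP; rewrite max_cycle_meanE cycle_mean_normalized //.
case: (\prod_(i <- c) B i (next c i)) => [|w] // [] /(canRL (addKr _)).
rewrite addNr => /eqP; rewrite mulf_eq0 invr_eq0 pnatr_eq0 size_eq0 (negPf c0).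
by rewrite orbF => /eqP ->.
Qed.

(** Around a cycle of maximal mean both the [B]-weight and the potential differences total 0, so the
    inequality is tight on each arc. *)
Lemma crit_arc_potential (x : 'I_d -> R) :
  (forall i j, B i j =< potential_mx x i j) ->
  forall i j, crit_arc F i j -> B i j = potential_mx x i j.
Proof.
move=> Bx i j /existsP[c /andP[maxc /andP[ic /eqP <-]]].
apply: mp_le_anti => //.
apply: (mp_prod_eq_le (f := fun i => B i (next c i))
  (g := fun i => potential_mx x i (next c i))) ic => [k _|k _|]; first exact: Bx.
  by rewrite mxE.
by rewrite prod_max_mean_cycle // prod_next_potential ?mp_lexx //;
  case/andP: maxc => /andP[_ /andP[]].
Qed.

End Normalization.

(** * The CSR term *)

Section CyclicNodes.
Variables (d : nat) (Z : seq 'I_d) (z0 : 'I_d).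
Hypotheses (Z_uniq : uniq Z) (Z_neq0 : Z != [::]).

(** Indexing by all naturals turns [k] steps along [Z] into adding [k]. *)
Definition cycle_node p : 'I_d := nth z0 Z (p %% size Z).

Let size_gt0 : (0 < size Z)%N. Proof. by rewrite lt0n size_eq0. Qed.

Lemma cycle_node_mod p : cycle_node (p %% size Z) = cycle_node p.
Proof. by rewrite /cycle_node modn_mod. Qed.

Lemma mem_cycle_node p : cycle_node p \in Z.
Proof. by rewrite mem_nth // ltn_pmod. Qed.

Lemma cycle_nodeP i : i \in Z -> exists p, i = cycle_node p.
Proof.
by exists (index i Z); rewrite /cycle_node modn_small ?index_mem // nth_index.
Qed.

Lemma next_cycle_node p : next Z (cycle_node p) = cycle_node p.+1.
Proof.
rewrite next_nth mem_cycle_node /cycle_node index_uniq ?ltn_pmod //.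
rewrite -[p.+1]addn1 -modnDml addn1; have := ltn_pmod p size_gt0.
case: (Z) => // i c; move: (p %% _)%N => {}p; rewrite ltnS leq_eqVlt.
case/predU1P => [->|pc] /=; first by rewrite nth_default // modnn.
by rewrite modn_small ?ltnS //= (set_nth_default i).
Qed.

Lemma size_cycle : (size Z <= d)%N.
Proof. by rewrite -(card_uniqP Z_uniq) (leq_trans (max_card _)) ?card_ord. Qed.

Lemma hamiltonian_node i : size Z = d -> exists p, i = cycle_node p.
Proof.
move=> sZ; apply: cycle_nodeP; have : #|Z| = #|'I_d|.
  by rewrite (card_uniqP Z_uniq) card_ord.
by move=> /subset_cardP/elimT/(_ (subset_predT _)) ->.
Qed.

End CyclicNodes.

Section CSR.
Variables (R : realType) (d : nat) (F : 'M[maxplus R]_d) (Z : seq 'I_d).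
Hypotheses (F_irr : irreducible_mx F) (lam_finite : max_cycle_mean F != NegInf)
  (Z_crit : critical_cycle F Z).
Local Notation B := (normalized_mx F).
Local Notation l := (size Z).

Let d_gt0 : (0 < d)%N.
Proof.
by case/andP: Z_crit; case: (Z) => // i *; exact: leq_ltn_trans (ltn_ord i).
Qed.

Let Z_neq0 : Z != [::]. Proof. by case/andP: Z_crit. Qed.
Let Z_uniq : uniq Z. Proof. by case/andP: Z_crit => _ /andP[]. Qed.
Let l_gt0 : (0 < l)%N. Proof. by rewrite lt0n size_eq0. Qed.

Local Notation z := (cycle_node Z (Ordinal d_gt0)).

Let z_mod p : z (p %% l) = z p. Proof. exact: cycle_node_mod. Qed.

Lemma arcs_normalized : arcs B =2 arcs F.
Proof. by move=> i j; rewrite /arcs mxE mp_mul_fin. Qed.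

Lemma normalized_potential : exists x, forall i j, B i j =< potential_mx x i j.
Proof.
apply: potential_exists; first exact: cycles_normalized_le1.
by move=> i j; rewrite (eq_connect arcs_normalized).
Qed.

Let cycles := closed_walks_le1 (cycles_normalized_le1 lam_finite).

Section Potential.
Variable x : 'I_d -> R.
Hypothesis Bx : forall i j, B i j =< potential_mx x i j.

Let crit_arc_z p : crit_arc F (z p) (z p.+1).
Proof.
rewrite -next_cycle_node //; apply: next_cycle; last exact: mem_cycle_node.
by case/andP: Z_crit => _ /andP[].
Qed.

Lemma csr_S_walk k p :
  potential_mx x (z p) (z (p + k)) =< (csr_S F Z ^+ k) (z p) (z (p + k)).
Proof.
elim: k p => [|k IH] p.
  by rewrite expr0 addn0 one_mx_diag mxE subrr mp_lexx.
rewrite exprS; apply: (mp_le_trans _ (mulmx_entry_le _ _ _ (z p.+1) _)).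
have -> : potential_mx x (z p) (z (p + k.+1)) =
    potential_mx x (z p) (z p.+1) * potential_mx x (z p.+1) (z (p.+1 + k)).
  by rewrite -addSnnS !mxE mp_mulFin; congr Fin; ring.
rewrite -addSnnS; apply: mp_leM => //.
rewrite -(crit_arc_potential lam_finite Bx (crit_arc_z p)) !mxE.
by rewrite /arc_of mem_cycle_node // next_cycle_node // eqxx mp_lexx.
Qed.

Lemma csr_S_le i j : csr_S F Z i j =< B i j.
Proof. by rewrite !mxE; case: ifP => // _; exact: mp_lexx. Qed.

Lemma normalized_walk k p :
  potential_mx x (z p) (z (p + k)) =< (B ^+ k) (z p) (z (p + k)).
Proof. exact: mp_le_trans (csr_S_walk k p) (expmx_le csr_S_le _ _ _). Qed.

(** Conjugation by the potential makes all weights nonpositive and those on [Z] zero; the powers are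
    conjugated in the same way. *)
Let N : 'M[maxplus R]_d := \matrix_(i, j) (B i j * Fin (x j - x i)).

Let expN t i j : (N ^+ t) i j = (B ^+ t) i j * Fin (x j - x i).
Proof.
elim: t i j => [|t IH] i j.
  rewrite !expr0 mxE; case: eqVneq => [->|_]; last by rewrite mul0r.
  by rewrite subrr mulr1.
rewrite !exprS -!mulmxE mxE [in RHS]mxE big_distrl /=; apply: eq_bigr => k _.
rewrite IH mxE mulrACA; congr (_ * _).
by rewrite mp_mulFin; congr Fin; ring.
Qed.

Lemma critical_column_le s t i p : ((d.-1) ^ 2 < t)%N -> s = t %[mod l] ->
  (B ^+ s) i (z p) =< (B ^+ t) i (z p).
Proof.
move=> dt st.
have N_le1 i' j : N i' j =< 1.
  rewrite mxE; have := Bx i' j; rewrite [potential_mx _ _ _]mxE.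
  case: (B i' j) => //= b.
  by rewrite /mp_le /= => ?; lra.
have N_z q : 1 =< N (z q) (z q.+1).
  rewrite mxE (crit_arc_potential lam_finite Bx (crit_arc_z q)) mxE mp_mulFin.
  by rewrite /mp_le /=; lra.
have : (N ^+ s) i (z p) =< (N ^+ t) i (z p).
  have [ld|ld|ld] := ltngtP l d.
  - exact: (expmx_critical_short l_gt0 z_mod N_le1 N_z).
  - by have := size_cycle Z_uniq; rewrite leqNgt ld.
  - apply: (expmx_critical_long l_gt0 z_mod N_le1 N_z) => // j.
    exact: hamiltonian_node.
by rewrite !expN !(mulrC _ (Fin _)) mp_leM2l.
Qed.

End Potential.

Lemma critical_column_eq s t i j : ((d.-1) ^ 2 < s)%N -> ((d.-1) ^ 2 < t)%N ->
  s = t %[mod l] -> j \in Z -> (B ^+ s) i j = (B ^+ t) i j.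
Proof.
move=> ds dt st /(cycle_nodeP (Ordinal d_gt0))[p ->].
have [x Bx] := normalized_potential.
by apply: mp_le_anti; apply: critical_column_le Bx _ _ _ _ _ _.
Qed.

Lemma csr_U_ge r i j : (0 < r)%N -> (B ^+ (l * r)) i j =< csr_U F Z i j.
Proof.
have U_ge r' : (r' < d)%N -> ((B ^+ l) ^+ r'.+1) i j =< csr_U F Z i j.
  move=> r'd; rewrite /csr_U /mp_plus summxE.
  apply: (mp_le_sum (P := predT) (fun k => ((B ^+ l) ^+ k) i j)) => //.
  by rewrite mem_index_iota.
(* One factor is set aside before the reduction below [d], so that the exponent stays in the range
   from 1 to [d] used by [csr_U]. *)
case: r => // r _; rewrite exprM exprS -mulmxE mxE; apply: mp_sum_ge => k _.
have closed r' i' : ((B ^+ l) ^+ r') i' i' =< 1 by rewrite -exprM cycles.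
have [r' [r'd _ le_r']] := expmx_reduce (ltn0Sn 0) closed r k j.
rewrite muln1 in r'd; apply: mp_le_trans (U_ge r' r'd); rewrite exprS.
apply: (mp_le_trans _ (mulmx_entry_le _ _ _ k _)).
exact: mp_leM.
Qed.

Lemma csr_U_attained i j : exists r, csr_U F Z i j =< (B ^+ (l * r)) i j.
Proof.
rewrite /csr_U /mp_plus summxE.
have [->|] := eqVneq (\sum_(1 <= r < d.+1) ((B ^+ l) ^+ r) i j) NegInf.
  by exists 0%N.
by case/mp_sum_attained=> r [_ _ ->]; exists r; rewrite exprM mp_lexx.
Qed.

(** Every term of the CSR product is bounded by a walk of length congruent to [t]. Conversely, an
    optimal walk of length [t] to [z p] is prolonged along [Z] to a length divisible by [l], and [k]
    steps of [csr_S] lead back to [z p]. *)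
Lemma csr_column t k i j : ((d.-1) ^ 2 < t)%N -> k = t %[mod l] -> j \in Z ->
  (csr_C F Z *m csr_S F Z ^+ k *m csr_R F Z) i j = (B ^+ t) i j.
Proof.
move=> dt kt jZ; have [p ->] := cycle_nodeP (Ordinal d_gt0) jZ.
have [x Bx] := normalized_potential.
apply: mp_le_anti.
  rewrite mxE; apply: mp_sum_ge => b _; rewrite mxE big_distrl /=.
  apply: mp_sum_ge => a _.
  have [r1 le_r1] := csr_U_attained i a.
  have [r2 le_r2] := csr_U_attained b (z p).
  have C_le : csr_C F Z i a =< (B ^+ (l * r1)) i a by rewrite mxE; case: ifP.
  have R_le : csr_R F Z b (z p) =< (B ^+ (l * r2)) b (z p).
    by rewrite mxE; case: ifP.
  have S_le : (csr_S F Z ^+ k) a b =< (B ^+ k) a b.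
    exact: expmx_le csr_S_le _ _ _.
  apply: mp_le_trans (mp_leM (mp_leM C_le S_le) R_le) _.
  apply: mp_le_trans (mp_leM (expmx_entry_le _ _ _ _ _ _) (mp_lexx _)) _.
  apply: mp_le_trans (expmx_entry_le _ _ _ _ _ _) _.
  apply: critical_column_le Bx _ _ _ _ dt _.
  by rewrite ![(l * _)%N]mulnC -addnA modnMDl addnC modnMDl.
(* From [z q], [k] more steps complete [k] turns; and [t + k * (l - 1)] is congruent to [k * l],
   hence to 0. *)
pose q := (p + k * l.-1)%N.
have zqk : z (q + k) = z p.
  rewrite -[LHS]z_mod -[RHS]z_mod; congr z.
  have -> : (q + k = k * l + p)%N by rewrite /q; nia.
  by rewrite modnMDl.
have [r Er] : exists r, (t + k * l.-1 = l * r)%N.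
  have /dvdnP[r Er] : (l %| t + k * l.-1)%N.
    rewrite /dvdn -modnDml -kt modnDml.
    have -> : (k + k * l.-1 = k * l)%N by nia.
    by rewrite modnMl.
  by exists r; rewrite Er mulnC.
have r_gt0 : (0 < r)%N 
  by case: r Er => // /eqP; rewrite muln0 addn_eq0; case: (t) dt.
have C_ge : (B ^+ t) i (z p) * potential_mx x (z p) (z q) =< csr_C F Z i (z q).
  rewrite [csr_C _ _ _ _]mxE mem_cycle_node //.
  apply: mp_le_trans (csr_U_ge _ _ r_gt0).
  rewrite -Er; apply: (mp_le_trans _ (expmx_entry_le _ _ _ _ (z p) _)).
  by apply: mp_leM => //; exact: normalized_walk.
have S_ge := csr_S_walk Bx k q; rewrite zqk in S_ge.
have R_ge : 1 =< csr_R F Z (z p) (z p).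
  rewrite mxE mem_cycle_node //; apply: mp_le_trans (csr_U_ge _ _ (ltn0Sn 0)).
  have := normalized_walk Bx l p; rewrite muln1.
  have -> : z (p + l) = z p by rewrite -z_mod modnDr z_mod.
  by rewrite mxE subrr.
apply: (mp_le_trans _ (mulmx_entry_le _ _ _ (z p) _)).
rewrite -[X in X =< _]mulr1; apply: mp_leM => //.
apply: (mp_le_trans _ (mulmx_entry_le _ _ _ (z q) _)).
apply: mp_le_trans (mp_leM C_ge S_ge).
rewrite -mulrA; apply: mp_leMr; rewrite !mxE mp_mulFin /mp_le /=; lra.
Qed.

(** * Monotonicity of the total over the columns of the cycle *)

Section CycleProduct.
Variables (m : nat) (V : 'M[maxplus R]_(m, d)) (r : 'I_m).
Hypothesis V_finite : forall i j, V i j != NegInf.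

Definition cycle_product t : maxplus R := \prod_(p < l) (V *m B ^+ t) r (z p).

Lemma prod_cycle_shift (h : 'I_d -> maxplus R) :
  \prod_(p < l) h (z p.+1) = \prod_(p < l) h (z p).
Proof.
have zl : z l = z 0 by rewrite -z_mod modnn.
move: zl; case: l l_gt0 => // n _ zn.
by rewrite big_ord_recr big_ord_recl /= zn mulrC.
Qed.

(** Prolonging a walk by the arc from [z p] to [z p.+1] changes its weight by a potential
    difference, and these differences cancel around the cycle. *)
Lemma cycle_product_le s t : (s <= t)%N -> cycle_product s =< cycle_product t.
Proof.
move=> st; rewrite -(subnKC st); elim: (t - s)%N => [|n IH].
  by rewrite addn0 mp_lexx.
apply: mp_le_trans IH _; rewrite addnS; move: (s + n)%N => {st}s.
have [x Bx] := normalized_potential.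
rewrite /cycle_product -(prod_cycle_shift (fun i => (V *m B ^+ s.+1) r i)).
have -> : \prod_(p < l) (V *m B ^+ s) r (z p) =
    \prod_(p < l) ((V *m B ^+ s) r (z p) * potential_mx x (z p) (z p.+1)).
  rewrite big_split /= -[LHS]mulr1; congr (_ * _).
  under eq_bigr do rewrite mxE -mp_mulFin.
  rewrite big_split /= (prod_cycle_shift (fun i => Fin (- x i))) -big_split /=.
  by rewrite big1 // => p _; rewrite mp_mulFin subrr.
apply: mp_prod_le => p _; rewrite exprSr -mulmxE mulmxA.
apply: (mp_le_trans _ (mulmx_entry_le _ _ _ (z p) _)).
apply: mp_leM => //; have := normalized_walk Bx 1 p.
by rewrite addn1 expr1.
Qed.

Lemma critical_column_mul_eq s t j : ((d.-1) ^ 2 < s)%N -> ((d.-1) ^ 2 < t)%N ->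
  s = t %[mod l] -> j \in Z -> (V *m B ^+ s) r j = (V *m B ^+ t) r j.
Proof.
move=> ds dt st jZ; rewrite !mxE; apply: eq_bigr => k _.
by rewrite (critical_column_eq _ ds dt).
Qed.

Lemma cycle_product_const s t : ((d.-1) ^ 2 < s)%N -> ((d.-1) ^ 2 < t)%N ->
  cycle_product s = cycle_product t.
Proof.
suff le s' t' : ((d.-1) ^ 2 < s')%N -> ((d.-1) ^ 2 < t')%N ->
    cycle_product s' =< cycle_product t'.
  by move=> ds dt; apply: mp_le_anti; exact: le.
(* The time [s' * l + t'] is at least [s'] and congruent to [t'], so monotonicity and periodicity
   combine. *)
move=> ds dt; have le_s : (s' <= s' * l + t')%N by nia.
apply: mp_le_trans (cycle_product_le le_s) _.
have -> : cycle_product (s' * l + t') = cycle_product t'; last exact: mp_lexx.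
apply: eq_bigr => p _; apply: critical_column_mul_eq => //; first by lia.
  by rewrite modnMDl.
exact: mem_cycle_node.
Qed.

Lemma cycle_product_fin t : cycle_product t != NegInf.
Proof.
apply: (mp_le_fin (cycle_product_le (leq0n t))).
by apply: mp_prod_fin => p _; rewrite expr0 mulmx1.
Qed.

(** A common shift by [c] changes the constant real sum [cycle_product] by [c] times the length of
    [Z]. *)
Lemma critical_columns_shift0 (c : R) s t :
  ((d.-1) ^ 2 < s)%N -> ((d.-1) ^ 2 < t)%N ->
  (forall j, j \in Z -> (V *m B ^+ s) r j = Fin c * (V *m B ^+ t) r j) -> c = 0.
Proof.
move=> ds dt col_eq; have := cycle_product_const ds dt.
rewrite /cycle_product (eq_bigr _ (fun p _ => col_eq _ (mem_cycle_node _ Z_neq0 _))).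
rewrite big_split /= prodr_const card_ord mp_exprFin -/(cycle_product t).
case: (cycle_product t) (cycle_product_fin t) => // a _ [] /(canRL (addrK _)).
by rewrite subrr => /eqP; rewrite mulrn_eq0 size_eq0 (negPf Z_neq0) => /eqP.
Qed.

End CycleProduct.
End CSR.

(** * The algorithm *)

Section DiscreteLog.
Variables (R : realType) (m d : nat) (V : 'M[maxplus R]_(m, d))
  (F : 'M[maxplus R]_d) (Z : seq 'I_d).
Hypotheses (m_gt0 : (0 < m)%N) (V_finite : forall i j, V i j != NegInf)
  (F_irr : irreducible_mx F) (lam_finite : max_cycle_mean F != NegInf)
  (lam_neq0 : max_cycle_mean F != Fin 0) (Z_crit : critical_cycle F Z).
Local Notation B := (normalized_mx F).

Let lamF_neq0 : lam F != 0.
Proof.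
by apply: contra lam_neq0 => /eqP l0; rewrite max_cycle_meanE // l0.
Qed.

Lemma mulmx_normalized t r i :
  (V *m F ^+ t) r i = Fin (lam F *+ t) * (V *m B ^+ t) r i.
Proof.
rewrite !mxE big_distrr /=; apply: eq_bigr => k _.
by rewrite expmx_normalized mulrCA.
Qed.

Lemma mulmx_expr_inj s t : V *m F ^+ s = V *m F ^+ t -> s = t.
Proof.
(* Multiplication by [F ^+ w] moves both exponents beyond the bound. *)
move=> E; pose w := ((d.-1 ^ 2).+1)%N.
have Ew : V *m F ^+ (s + w) = V *m F ^+ (t + w).
  by rewrite !exprD -!mulmxE !mulmxA E.
have : lam F *+ (t + w) - lam F *+ (s + w) = 0.
  apply: (critical_columns_shift0 F_irr lam_finite Z_crit
    (r := Ordinal m_gt0) V_finite (s := (s + w)%N) (t := (t + w)%N));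
    [by lia | by lia | move=> j _].
  apply: (@mp_mulI _ (lam F *+ (s + w))).
  by rewrite -mulmx_normalized Ew mulmx_normalized mulrA mp_mulFin addrC subrK.
move/eqP; rewrite subr_eq0 => /eqP/mulrIn; rewrite lamF_neq0 => /(_ isT).
by move/addIn.
Qed.

Lemma part2_accepts_large k t : (d.-1 ^ 2 < t)%N -> k = t %[mod size Z] ->
  part2_accepts (V *m F ^+ t) V F Z k t.
Proof.
move=> dt kt; exists (lam F *+ t); split; last first.
  by rewrite -(mulr_natr (lam F)) mulrAC divff ?mul1r.
move=> i iZ; apply/matrixP => r c; rewrite [LHS]mxE mulmx_normalized [RHS]mxE.
congr (_ * _); rewrite !mxE; apply: eq_bigr => j _; rewrite [in RHS]mxE.
by rewrite (csr_column F_irr lam_finite Z_crit j dt kt iZ).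
Qed.

Lemma part2_accepts_unique k s t : (d.-1 ^ 2 < t)%N ->
  part2_accepts (V *m F ^+ t) V F Z k s -> s = t.
Proof.
move=> dt [mu [cols mu_s]].
have l_gt0 : (0 < size Z)%N by rewrite lt0n size_eq0; case/andP: Z_crit.
(* A large time congruent to [k], at which the CSR term is a power of [B]; no congruence between [k]
   and [t] is assumed. *)
pose T := ((d.-1 ^ 2).+1 * size Z + k)%N.
have dT : (d.-1 ^ 2 < T)%N by rewrite /T; nia.
have kT : k = T %[mod size Z] by rewrite modnMDl.
have mu0 : mu - lam F *+ t = 0.
  apply: (critical_columns_shift0 F_irr lam_finite Z_crit
    (r := Ordinal m_gt0) V_finite dt dT) => j jZ.
  apply: (@mp_mulI _ (lam F *+ t)); rewrite -mulmx_normalized.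
  rewrite mulrA mp_mulFin addrC subrK.
  have /matrixP/(_ (Ordinal m_gt0) ord0) := cols j jZ.
  rewrite [LHS]mxE [RHS]mxE => ->; congr (_ * _).
  rewrite !mxE; apply: eq_bigr => i _; rewrite [in LHS]mxE.
  by rewrite (csr_column F_irr lam_finite Z_crit i dT kT jZ).
move: mu_s; rewrite (subr0_eq mu0) -(mulr_natr (lam F)) mulrAC divff // mul1r => /eqP.
by rewrite eqr_nat => /eqP.
Qed.

Lemma dlog_run_sound t o : dlog_run (V *m F ^+ t) V F Z o -> o = Some t.
Proof.
have large : part1_fails (V *m F ^+ t) V F -> (d.-1 ^ 2 < t)%N.
  by move=> fails; rewrite ltnNge; apply/negP => /fails; apply.
case=> [s _ /mulmx_expr_inj-> //|k s /large dt _ /(part2_accepts_unique dt)-> //|].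
move=> /large dt no; case: (no (t %% size Z)%N t).
  by rewrite ltn_pmod // lt0n size_eq0; case/andP: Z_crit.
by apply: part2_accepts_large => //; rewrite modn_mod.
Qed.

Lemma dlog_run_complete t : dlog_run (V *m F ^+ t) V F Z (Some t).
Proof.
have [td|dt] := leqP t (d.-1 ^ 2)%N.
  by apply: dlog_part1 => // s st /mulmx_expr_inj Est; rewrite Est ltnn in st.
(* By uniqueness every accepted [k] yields [t], so the first [k] accepted with output [t] is the
   first accepted at all; it is at most [t] modulo the length of [Z]. *)
pose accepts k := `[< part2_accepts (V *m F ^+ t) V F Z k t >].
have acc : exists k, accepts k.
  exists (t %% size Z)%N; apply/asboolP/part2_accepts_large => //.
  by rewrite modn_mod.
have l_gt0 : (0 < size Z)%N by rewrite lt0n size_eq0; case/andP: Z_crit.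
have [k /asboolP acc_k k_min] := ex_minnP acc.
apply: (dlog_part2 (k := k)) => //.
- by move=> s sd /mulmx_expr_inj Est; rewrite Est ltnNge sd in dt.
- apply: leq_ltn_trans (ltn_pmod t l_gt0); apply: k_min.
  by apply/asboolP/part2_accepts_large => //; rewrite modn_mod.
move=> k' s k'k acc_k'; move: (part2_accepts_unique dt acc_k') => Est.
rewrite {}Est in acc_k'; have /asboolP/k_min := acc_k'.
by rewrite leqNgt k'k.
Qed.

End DiscreteLog.

Theorem corollary2p13 (R : realType) (m d : nat)
    (A V : 'M[maxplus R]_(m, d)) (F : 'M[maxplus R]_d)
    (Z : seq 'I_d) (t : nat)
    (m_gt0 : (0 < m)%N)
    (V_finite : forall i j, V i j != NegInf)
    (F_irr : irreducible_mx F)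
    (lam_finite : max_cycle_mean F != NegInf)
    (crit_sc : strongly_connected_crit F)
    (lam_neq0 : max_cycle_mean F != Fin 0)
    (Z_crit : critical_cycle F Z)
    (A_def : A = V *m F ^+ t) :
  forall o : option nat, dlog_run A V F Z o <-> o = Some t.
Proof.
move=> o; rewrite A_def; split; first exact: dlog_run_sound.
by move=> ->; exact: dlog_run_complete.
Qed.
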